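(* Let $\pi:\mathcal C(p,q)\to M$ be a homomorphism of the bicyclic semigroup (with the discrete topology) into a Hausdorff topological semigroup $M$ such that $Z=\pi(\mathcal C(p,q))$ is a dense infinite cyclic subgroup of $M$ and $M$ is countably compact at $Z$. Let $S=\mathcal C(p,q)\cup_\pi M$. Then: (1) if $M$ is countably compact, then so is $S$; (2) the following are equivalent: $S$ is a topological semigroup; for every $c\in\mathcal C(p,q)$ the set $D_c=\{(x,y)\in\mathcal C(p,q)^2:xy=c\}$ is closed in $S\times S$; the set $\{(\pi(q^n),\pi(p^n)):n\in\omega\}$ is closed and discrete in $M\times M$; (3) $S$ is a topological semigroup provided $Z$ is discrete in $M$ and $M\setminus Z$ is an ideal in $M$; (4) if $S$ is a topological semigroup, then $S\times S$ is not pseudocompact; (5) if $S$ is a topological semigroup and $M$ is Tychonoff, then (a) $M$ is not openly factorizable, (b) $M\times M$ is not pseudocompact, and (c) $M$ contains no dense totally bounded topological subgroup.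
   Context: The bicyclic semigroup $\mathcal C(p,q)$ is the semigroup with identity $1$ generated by $p,q$ subject to the single relation $qp=1$; every element is uniquely $p^nq^m$ ($n,m\in\omega$), and $p^mq^n\cdot p^iq^j$ equals $p^mq^{n-i+j}$ if $n\ge i$ and $p^{m+i-n}q^j$ if $n\le i$. For a discrete space $D$: if $D$ is infinite, $\alpha D=D\cup\{\infty\}$ is its one-point compactification; if finite, $\alpha D$ is the sum of $D$ and an isolated point $\infty$. For a map $\pi:D\to M$, $D\cup_\pi M$ is the subspace $\{(x,\pi(x)):x\in D\}\cup(\{\infty\}\times M)$ of $\alpha D\times M$, with $D$ identified with $\{(x,\pi(x))\}$ and $M$ with $\{\infty\}\times M$; for a semigroup homomorphism $\pi$ it carries the semigroup operation extending those of $D$ and $M$ by $xy=\pi(x)y$ ($x\in D,y\in M$) and $xy=x\pi(y)$ ($x\in M,y\in D$), making it a semitopological semigroup. A space $X$ is countably compact at $A\subset X$ if every infinite $B\subset A$ has an accumulation point in $X$. Pseudocompact: every locally finite open cover is finite. Openly factorizable: every continuous map $f:X\to Y$ to a separable metrizable $Y$ factors as $f=g\circ p$ with $p:X\to K$ an open continuous surjection onto a separable metrizable $K$ and $g:K\to Y$ continuous. *)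

(* Defs.v *)
From Stdlib Require Import Reals List Arith.
Open Scope R_scope.

Definition finite {X : Type} (A : X -> Prop) : Prop :=
  exists l : list X, forall x, A x -> In x l.
Definition infinite {X : Type} (A : X -> Prop) : Prop := ~ finite A.

Definition finite_family {X : Type} (F : (X -> Prop) -> Prop) : Prop :=
  exists l : list (X -> Prop), forall V, F V -> exists W, In W l /\ (forall x, V x <-> W x).

Definition topology (X : Type) := (X -> Prop) -> Prop.

Definition is_topology {X : Type} (T : topology X) : Prop :=
  T (fun _ => True) /\
  (forall U V, T U -> T V -> T (fun x => U x /\ V x)) /\
  (forall F : (X -> Prop) -> Prop, (forall U, F U -> T U) ->
     T (fun x => exists U, F U /\ U x)).

Definition closed {X : Type} (T : topology X) (C : X -> Prop) : Prop :=
  T (fun x => ~ C x).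

Definition dense {X : Type} (T : topology X) (A : X -> Prop) : Prop :=
  forall U, T U -> (exists x, U x) -> exists x, U x /\ A x.

Definition discrete_set {X : Type} (T : topology X) (A : X -> Prop) : Prop :=
  forall a, A a -> exists U, T U /\ U a /\ (forall b, A b -> U b -> b = a).

Definition hausdorff {X : Type} (T : topology X) : Prop :=
  forall x y, x <> y -> exists U V, T U /\ T V /\ U x /\ V y /\
    (forall z, U z -> V z -> False).

Definition continuous {X Y : Type} (TX : topology X) (TY : topology Y) (f : X -> Y) : Prop :=
  forall V, TY V -> TX (fun x => V (f x)).

Definition open_map {X Y : Type} (TX : topology X) (TY : topology Y) (f : X -> Y) : Prop :=
  forall U, TX U -> TY (fun y => exists x, U x /\ f x = y).

Definition product_top {X Y : Type} (TX : topology X) (TY : topology Y) : topology (X * Y) :=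
  fun O => forall z, O z -> exists U V, TX U /\ TY V /\ U (fst z) /\ V (snd z) /\
     (forall a b, U a -> V b -> O (a, b)).

Definition pullback_top {A B : Type} (f : A -> B) (T : topology B) : topology A :=
  fun O => exists W, T W /\ (forall a, O a <-> W (f a)).

(** alpha D for a discrete space D: None plays the role of the point infinity.
    If D is infinite this is the one-point compactification; if D is finite
    the condition is vacuous, so infinity is isolated (topological sum). *)
Definition alpha_top (D : Type) : topology (option D) :=
  fun O => O None -> finite (fun d => ~ O (Some d)).

Definition accumulation_point {X : Type} (T : topology X) (B : X -> Prop) (x : X) : Prop :=
  forall U, T U -> U x -> exists b, B b /\ U b /\ b <> x.

Definition countably_compact_at {X : Type} (T : topology X) (A : X -> Prop) : Prop :=
  forall B : X -> Prop, (forall x, B x -> A x) -> infinite B ->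
    exists x, accumulation_point T B x.

Definition countably_compact {X : Type} (T : topology X) : Prop :=
  countably_compact_at T (fun _ => True).

Definition locally_finite {X : Type} (T : topology X) (F : (X -> Prop) -> Prop) : Prop :=
  forall x, exists U, T U /\ U x /\
    finite_family (fun V => F V /\ exists y, U y /\ V y).

Definition open_cover {X : Type} (T : topology X) (F : (X -> Prop) -> Prop) : Prop :=
  (forall V, F V -> T V) /\ (forall x, exists V, F V /\ V x).

Definition pseudocompact {X : Type} (T : topology X) : Prop :=
  forall F, open_cover T F -> locally_finite T F -> finite_family F.

Definition is_metric {K : Type} (d : K -> K -> R) : Prop :=
  (forall x y, 0 <= d x y) /\ (forall x y, d x y = 0 <-> x = y) /\
  (forall x y, d x y = d y x) /\ (forall x y z, d x z <= d x y + d y z).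

Definition metric_top {K : Type} (d : K -> K -> R) : topology K :=
  fun O => forall x, O x -> exists eps, 0 < eps /\ forall y, d x y < eps -> O y.

Definition metrizable {K : Type} (T : topology K) : Prop :=
  exists d, is_metric d /\ forall O, T O <-> metric_top d O.

Definition countable {K : Type} (A : K -> Prop) : Prop :=
  exists f : nat -> option K, forall x, A x -> exists n, f n = Some x.

Definition separable {K : Type} (T : topology K) : Prop :=
  exists A, countable A /\ dense T A.

Definition separable_metrizable {K : Type} (T : topology K) : Prop :=
  separable T /\ metrizable T.

Definition R_top : topology R := metric_top (fun x y => Rabs (x - y)).

Definition tychonoff {X : Type} (T : topology X) : Prop :=
  (forall x : X, closed T (fun y => y = x)) /\
  (forall (C : X -> Prop) x, closed T C -> ~ C x ->
     exists f : X -> R, continuous T R_top f /\ f x = 0 /\ (forall y, C y -> f y = 1)).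

Definition openly_factorizable {X : Type} (TX : topology X) : Prop :=
  forall (Y : Type) (TY : topology Y), is_topology TY -> separable_metrizable TY ->
  forall f : X -> Y, continuous TX TY f ->
  exists (K : Type) (TK : topology K), is_topology TK /\ separable_metrizable TK /\
    exists (p : X -> K) (g : K -> Y),
      continuous TX TK p /\ open_map TX TK p /\ (forall k, exists x, p x = k) /\
      continuous TK TY g /\ (forall x, f x = g (p x)).

Definition associative {X : Type} (mul : X -> X -> X) : Prop :=
  forall x y z, mul x (mul y z) = mul (mul x y) z.

Definition topological_semigroup {X : Type} (T : topology X) (mul : X -> X -> X) : Prop :=
  associative mul /\
  forall x y V, T V -> V (mul x y) ->
    exists U W, T U /\ T W /\ U x /\ W y /\ (forall a b, U a -> W b -> V (mul a b)).

Definition ideal {X : Type} (mul : X -> X -> X) (I : X -> Prop) : Prop :=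
  (exists x, I x) /\ (forall x y, I x -> I (mul x y) /\ I (mul y x)).

Fixpoint npow {X : Type} (mul : X -> X -> X) (e g : X) (n : nat) : X :=
  match n with O => e | S k => mul (npow mul e g k) g end.

Definition infinite_cyclic_subgroup {X : Type} (mul : X -> X -> X) (Z : X -> Prop) : Prop :=
  exists e g h : X,
    mul e e = e /\ mul e g = g /\ mul g e = g /\ mul e h = h /\ mul h e = h /\
    mul g h = e /\ mul h g = e /\
    (forall z, Z z <-> exists n, z = npow mul e g n \/ z = npow mul e h n) /\
    (forall n, npow mul e g (S n) <> e).

Definition totally_bounded_topological_subgroup {X : Type} (T : topology X)
    (mul : X -> X -> X) (H : X -> Prop) : Prop :=
  exists (e : X) (inv : X -> X),
    H e /\ (forall h, H h -> mul e h = h /\ mul h e = h) /\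
    (forall a b, H a -> H b -> H (mul a b)) /\
    (forall h, H h -> H (inv h) /\ mul h (inv h) = e /\ mul (inv h) h = e) /\
    (forall x y V, H x -> H y -> T V -> V (mul x y) ->
       exists U W, T U /\ T W /\ U x /\ W y /\
         (forall a b, H a -> H b -> U a -> W b -> V (mul a b))) /\
    (forall x V, H x -> T V -> V (inv x) ->
       exists U, T U /\ U x /\ (forall a, H a -> U a -> V (inv a))) /\
    (forall U, T U -> U e ->
       exists l : list X, (forall f, In f l -> H f) /\
         forall h, H h -> exists f u, In f l /\ H u /\ U u /\ h = mul f u).

(** * The bicyclic semigroup: p^m q^n is encoded as (m, n). *)
Definition bicyclic : Type := (nat * nat)%type.

Definition bmul (a b : bicyclic) : bicyclic :=
  let (m, n) := a in let (i, j) := b in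
  if Nat.leb i n then (m, (n - i + j)%nat) else ((m + i - n)%nat, j).

Definition bone : bicyclic := (0%nat, 0%nat).
Definition bp : bicyclic := (1%nat, 0%nat).
Definition bq : bicyclic := (0%nat, 1%nat).
Definition bpow (x : bicyclic) (n : nat) : bicyclic := npow bmul bone x n.

Definition Sunion (M : Type) : Type := (bicyclic + M)%type.

Definition S_embed {M : Type} (pi : bicyclic -> M) (s : Sunion M) : option bicyclic * M :=
  match s with
  | inl c => (Some c, pi c)
  | inr m => (None, m)
  end.

Definition S_top {M : Type} (TM : topology M) (pi : bicyclic -> M) : topology (Sunion M) :=
  pullback_top (S_embed pi) (product_top (alpha_top bicyclic) TM).

Definition S_mul {M : Type} (mul : M -> M -> M) (pi : bicyclic -> M)
    (s t : Sunion M) : Sunion M :=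
  match s, t with
  | inl a, inl b => inl (bmul a b)
  | inl a, inr y => inr (mul (pi a) y)
  | inr x, inl b => inr (mul x (pi b))
  | inr x, inr y => inr (mul x y)
  end.

(* Main.v *)
Require Import Defs.
From Stdlib Require Import Reals List Arith Lia Lra Cantor.
From Stdlib Require Import ClassicalEpsilon FunctionalExtensionality
  PropExtensionality ProofIrrelevance.

(** Put [a = pi q] and [b = pi p]; these are inverse generators of [Z], and [M]
    is a commutative monoid with the unit of [Z], by density. Everything turns
    on local finiteness of the sequence [(a^n, b^n)] in [M * M]: it follows from
    closedness of the factorizations [(q^n, p^n)] of [1], and it gives
    continuity of the multiplication of [S] because the factorizations of any
    [p^m q^n] are sent to those of [1] by a finite-to-one translation.

    For (5), local finiteness at [(e, e)] gives a neighbourhood [U] of [e] with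
    [a^n, b^n] in [U] only for [n = 0]. A dense totally bounded group makes
    inversion continuous at [e] on the units of [M], and two powers of [a] in
    the same small coset then contradict this. In (a) and (b) let [phi] vanish
    at [e] and equal [1] off [U]. Both hypotheses make [x |-> phi (x y)]
    equicontinuous over [y]: in (b) by Frolik's lemma on pseudocompact products,
    in (a) by factoring the map [x |-> (phi (x z))_{z in Z}] through an open map
    to a metrizable space. A cluster point of the [a^n] then yields [n < k] with
    [a^(k-n)] and [b^(k-n)] both in [U]. *)

(** * Point-set topology *)

Lemma open_ext {X : Type} (T : topology X) (U V : X -> Prop) :
  T U -> (forall x, U x <-> V x) -> T V.
Proof.
  intros HU Heq. replace V with U; [exact HU|].
  apply functional_extensionality; intro x.
  apply propositional_extensionality; auto.
Qed.

Lemma open_of_nbhds {X : Type} (T : topology X) (U : X -> Prop) :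
  is_topology T ->
  (forall x, U x -> exists V, T V /\ V x /\ forall y, V y -> U y) -> T U.
Proof.
  intros (_ & _ & Hun) Hloc.
  apply open_ext with
    (fun x => exists V, (T V /\ forall y, V y -> U y) /\ V x).
  - apply (Hun (fun V => T V /\ forall y, V y -> U y)); tauto.
  - intro x; split.
    + intros (V & (_ & HV) & Hx); auto.
    + intro Hx; destruct (Hloc x Hx) as (V & ? & ? & ?); exists V; auto.
Qed.

Lemma open_avoiding_list {X : Type} (T : topology X) (l : list X) (m : X) (V : X -> Prop) :
  is_topology T -> hausdorff T -> T V -> V m ->
  exists W, T W /\ W m /\ (forall x, W x -> V x) /\
    (forall x, In x l -> W x -> x = m).
Proof.
  intros HT Hh HV Hm. induction l as [|y l (W & HW & HWm & HWV & HWl)].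
  - exists V; firstorder.
  - destruct (classic (y = m)) as [->|Hne].
    + exists W; repeat split; auto. intros x [<-|Hx] Wx; auto.
    + destruct (Hh y m Hne) as (A & B & HA & HB & Ay & Bm & HAB).
      exists (fun x => W x /\ B x); repeat split; try tauto.
      * apply HT; auto.
      * firstorder.
      * intros x [<-|Hx] [Wx Bx]; [destruct (HAB y); auto|auto].
Qed.

Lemma continuous_eq_on_dense {X Y : Type} (TX : topology X) (TY : topology Y)
    (A : X -> Prop) (f g : X -> Y) :
  is_topology TX -> hausdorff TY -> dense TX A ->
  continuous TX TY f -> continuous TX TY g ->
  (forall x, A x -> f x = g x) -> forall x, f x = g x.
Proof.
  intros HT Hh Hd Hf Hg Heq x. apply NNPP; intro Hne.
  destruct (Hh _ _ Hne) as (U & V & HU & HV & Ux & Vx & HUV).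
  destruct (Hd (fun x => U (f x) /\ V (g x))) as (z & [Hz1 Hz2] & Az).
  - apply HT; [apply Hf|apply Hg]; auto.
  - eauto.
  - apply (HUV (f z)); auto. rewrite Heq; auto.
Qed.

Lemma finite_list_inter {X I : Type} (T : topology X) (l : list I) (x : X)
    (P : I -> (X -> Prop)) :
  is_topology T ->
  (forall i, In i l -> exists U, T U /\ U x /\ forall y, U y -> P i y) ->
  exists U, T U /\ U x /\ forall y, U y -> forall i, In i l -> P i y.
Proof.
  intros HT. induction l as [|i l IH]; intro H.
  - exists (fun _ => True); repeat split; try apply HT; intros _ _ i [].
  - destruct IH as (U & HU & Ux & UP); [intros; apply H; right; auto|].
    destruct (H i) as (V & HV & Vx & VP); [left; auto|].
    exists (fun y => U y /\ V y); repeat split; auto.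
    + apply HT; auto.
    + intros y [Uy Vy] j [<-|Hj]; auto.
Qed.

Lemma open_box {X Y : Type} (TX : topology X) (TY : topology Y)
    (U : X -> Prop) (V : Y -> Prop) :
  TX U -> TY V -> product_top TX TY (fun z => U (fst z) /\ V (snd z)).
Proof. intros HU HV z [Uz Vz]. exists U, V; auto 10. Qed.

(** * Infinite sets, cluster points and pseudocompact products *)

Lemma infinite_not_in_list {X : Type} (A : X -> Prop) (l : list X) :
  infinite A -> exists x, A x /\ ~ In x l.
Proof.
  intro H. apply NNPP; intro Hn. apply H; exists l. intros x Ax.
  apply NNPP; intro; apply Hn; eauto.
Qed.

Lemma list_nat_bound (l : list nat) : exists N : nat, forall n, In n l -> (n < N)%nat.
Proof.
  exists (S (list_max l)). intros n Hn.
  pose proof (proj1 (list_max_le l (list_max l)) (le_n _)) as H.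
  rewrite Forall_forall in H. specialize (H n Hn). lia.
Qed.

(** Otherwise each [x] in [l] has a bound past which [P n x] fails, and at the sum of these bounds
    no element of [l] is left as a witness. *)
Lemma infinite_pigeonhole {X : Type} (l : list X) (P : nat -> X -> Prop) :
  (forall n, exists x, In x l /\ P n x) ->
  exists x, In x l /\ forall N : nat, exists n, (N <= n)%nat /\ P n x.
Proof.
  intro H. apply NNPP; intro Hn.
  assert (HN : exists N : nat, forall n, (N <= n)%nat -> forall x, In x l -> ~ P n x).
  { clear H. induction l as [|x l IH].
    - exists 0%nat; intros n _ x [].
    - destruct IH as [N1 HN1].
      { intros (y & Hy & HP); apply Hn; exists y; split; [right|]; auto. }
      assert (Hx : exists N : nat, forall n, (N <= n)%nat -> ~ P n x).
      { apply NNPP; intro Hx; apply Hn; exists x; split; [left; auto|].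
        intro N. apply NNPP; intro HN; apply Hx; exists N; intros n Hle HP.
        apply HN; eauto. }
      destruct Hx as [N2 HN2].
      exists (N1 + N2)%nat; intros n Hle y [<-|Hy].
      + apply HN2; lia.
      + apply HN1; auto; lia. }
  destruct HN as [N HN]. destruct (H N) as (x & Hx & HP). exact (HN N (le_n N) x Hx HP).
Qed.

(** Since [f] may identify points, there are two cases. If [B] has finite image, some fibre is
    infinite and its value serves as [m]. Otherwise an accumulation point of the image serves, and
    Hausdorffness lets a neighbourhood avoid any finite set of values other than [m]. *)
Lemma cluster_of_infinite {X M : Type} (TM : topology M) (A : M -> Prop)
    (f : X -> M) (B : X -> Prop) :
  is_topology TM -> hausdorff TM -> countably_compact_at TM A ->
  (forall x, A (f x)) -> infinite B ->
  exists m, forall V, TM V -> V m -> infinite (fun x => B x /\ V (f x)).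
Proof.
  intros HT Hh Hcc HA HB.
  destruct (classic (finite (fun y => exists x, B x /\ f x = y))) as [[l Hl]|Hinf].
  - apply NNPP; intro Hn. apply HB.
    assert (Hfib : forall y, exists k, forall x, B x /\ f x = y -> In x k).
    { intro y. apply NNPP; intro Hy. apply Hn; exists y. intros V _ Vy [k Hk].
      apply Hy; exists k; intros x [Bx <-]; auto. }
    destruct (choice _ Hfib) as [k Hk].
    exists (flat_map k l). intros x Bx. apply in_flat_map.
    exists (f x); split; eauto.
  - destruct (Hcc _ (fun y Hy => match Hy with
        ex_intro _ x (conj _ e) => eq_ind _ A (HA x) _ e end) Hinf) as [m Hm].
    exists m. intros V HV Vm [l Hl].
    destruct (open_avoiding_list TM (map f l) m V HT Hh HV Vm)
      as (W & HW & Wm & HWV & HWl).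
    destruct (Hm W HW Wm) as (y & (x & Bx & <-) & Wy & Hne).
    apply Hne, HWl; auto. apply in_map, Hl; auto.
Qed.

Lemma cluster_of_sequence {M : Type} (TM : topology M) (A : M -> Prop) (f : nat -> M) :
  is_topology TM -> hausdorff TM -> countably_compact_at TM A ->
  (forall n, A (f n)) ->
  exists m, forall V, TM V -> V m -> forall N, exists n, (N <= n)%nat /\ V (f n).
Proof.
  intros HT Hh Hcc HA.
  destruct (cluster_of_infinite TM A f (fun _ => True) HT Hh Hcc HA) as [m Hm].
  - intros [l Hl]. destruct (list_nat_bound l) as [N HN].
    specialize (HN N (Hl N I)). lia.
  - exists m. intros V HV Vm N.
    destruct (infinite_not_in_list _ (seq 0 N) (Hm V HV Vm)) as (n & [_ Vn] & Hn).
    exists n; split; auto. rewrite in_seq in Hn. lia.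
Qed.

(** Without such a point the boxes with sides [U n] and [V n] are locally finite. Pseudocompactness
    then makes boxes of arbitrarily large index coincide, which contradicts local finiteness at any
    point of their common set. *)
Lemma pseudocompact_product_cluster {X Y : Type} (TX : topology X) (TY : topology Y)
    (U : nat -> X -> Prop) (V : nat -> Y -> Prop) :
  is_topology TX -> is_topology TY -> pseudocompact (product_top TX TY) ->
  (forall n, TX (U n)) -> (forall n, TY (V n)) ->
  (forall n, exists x, U n x) -> (forall n, exists y, V n y) ->
  exists x y, forall A B, TX A -> TY B -> A x -> B y ->
    forall N, exists n, (N <= n)%nat /\
      (exists u, U n u /\ A u) /\ (exists v, V n v /\ B v).
Proof.
  intros HTX HTY Hps HU HV Ue Ve. apply NNPP; intro Hn.
  assert (Hloc : forall x y, exists A B N, TX A /\ TY B /\ A x /\ B y /\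
    forall n u v, (N <= n)%nat -> U n u -> A u -> V n v -> B v -> False).
  { intros x y. apply NNPP; intro Hc. apply Hn; exists x, y.
    intros A B HA HB Ax By N. apply NNPP; intro HN. apply Hc; exists A, B, N.
    repeat split; auto. intros n u v Hle Uu Au Vv Bv. apply HN; eauto 10. }
  set (box := fun n (z : X * Y) => U n (fst z) /\ V n (snd z)).
  (* The whole space is adjoined to turn the boxes into a cover. *)
  set (F := fun O : X * Y -> Prop => O = (fun _ => True) \/ exists n, O = box n).
  destruct (Hps F) as [l Hl].
  - split.
    + intros O [->|[n ->]].
      * intros z _; exists (fun _ => True), (fun _ => True).
        repeat split; auto; [apply HTX|apply HTY].
      * apply open_box; auto.
    + intro z; exists (fun _ => True); split; [left|]; auto.
  - intros [x y]. destruct (Hloc x y) as (A & B & N & HA & HB & Ax & By & HN).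
    exists (fun z => A (fst z) /\ B (snd z)). split; [apply open_box; auto|].
    split; [auto|].
    exists ((fun _ => True) :: map box (seq 0 N)).
    intros O [[->|[n ->]] ([u v] & [Au Bv] & Ouv)].
    + exists (fun _ => True); split; [left; auto|tauto].
    + exists (box n); split; [right; apply in_map, in_seq|tauto].
      destruct Ouv as [Uu Vv]; simpl in *.
      destruct (le_lt_dec N n); [destruct (HN n u v)|]; auto; lia.
  - destruct (infinite_pigeonhole l (fun n W => forall z, box n z <-> W z))
      as (W & _ & HW).
    { intro n. apply (Hl (box n)). right; eauto. }
    destruct (HW 0%nat) as (n0 & _ & H0).
    destruct (Ue n0) as [u Uu], (Ve n0) as [v Vv].
    destruct (Hloc u v) as (A & B & N & _ & _ & Au & Bv & HN).
    destruct (HW N) as (n & Hle & H1).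
    destruct (proj2 (H1 (u, v))) as [Uu' Vv'].
    { apply H0; split; auto. }
    apply (HN n u v); auto.
Qed.

(** * Equicontinuity of the sections of a real function on a product *)

Definition jointly_continuous {X Y : Type} (TX : topology X) (TY : topology Y)
    (phi : X -> Y -> R) : Prop :=
  forall x y eps, 0 < eps -> exists A B, TX A /\ TY B /\ A x /\ B y /\
    forall u v, A u -> B v -> Rabs (phi u v - phi x y) < eps.

(** One neighbourhood [A] serves all [y]. The bound is not strict, so that its failure is a strict
    inequality, which survives small moves of the points. *)
Definition equicontinuous_at {X Y : Type} (TX : topology X)
    (phi : X -> Y -> R) (m : X) : Prop :=
  forall eps, 0 < eps -> exists A, TX A /\ A m /\
    forall x y, A x -> Rabs (phi x y - phi m y) <= eps.

(** Frolik's argument: a failure of equicontinuity at [m] yields boxes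
    [U n * V n], with [U n] inside ever smaller neighbourhoods [W n] of [m],
    which cannot cluster anywhere. *)
Lemma pseudocompact_product_equicontinuous {X Y : Type} (TX : topology X)
    (TY : topology Y) (phi : X -> Y -> R) (m : X) :
  is_topology TX -> is_topology TY -> pseudocompact (product_top TX TY) ->
  jointly_continuous TX TY phi -> equicontinuous_at TX phi m.
Proof.
  intros HTX HTY Hps Hphi eps Heps. apply NNPP; intro Hn.
  (* Neighbourhoods of [m] are packed with their proofs so that choice can iterate the passage from
     [W] to a smaller [W']. *)
  set (N := {W : X -> Prop | TX W /\ W m}).
  assert (Hstep : forall W : N, exists t : (X -> Prop) * (Y -> Prop) * N,
    let '(U, V, W') := t in
    TX U /\ TY V /\ (exists x, U x) /\ (exists y, V y) /\
    (forall x, proj1_sig W' x -> proj1_sig W x) /\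
    (forall x, U x -> proj1_sig W x) /\
    (forall u v w, U u -> V v -> proj1_sig W' w ->
       eps / 2 < Rabs (phi u v - phi w v))).
  { intros [W [HW Wm]].
    assert (Hxy : exists x y, W x /\ eps < Rabs (phi x y - phi m y)).
    { apply NNPP; intro Hc. apply Hn; exists W; repeat split; auto.
      intros x y Wx. apply Rnot_lt_le; intro; apply Hc; eauto. }
    destruct Hxy as (x & y & Wx & Hxy).
    (* Two errors of [eps / 4], at [x] and at [m], leave [eps / 2] of the gap [eps]. *)
    destruct (Hphi x y (eps / 4)) as (A & V1 & HA & HV1 & Ax & V1y & H1); [lra|].
    destruct (Hphi m y (eps / 4)) as (B & V2 & HB & HV2 & Bm & V2y & H2); [lra|].
    assert (HW' : TX (fun z => B z /\ W z) /\ (B m /\ W m)).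
    { split; auto; apply HTX; auto. }
    exists (fun z => A z /\ W z, fun z => V1 z /\ V2 z, exist (fun O => TX O /\ O m) _ HW').
    simpl. repeat split.
    - apply HTX; auto.
    - apply HTY; auto.
    - eauto.
    - eauto.
    - tauto.
    - tauto.
    - intros u v w [Au _] [V1v V2v] [Bw _].
      specialize (H1 u v Au V1v). specialize (H2 w v Bw V2v).
      revert Hxy H1 H2. unfold Rabs. repeat destruct Rcase_abs; lra. }
  destruct (choice _ Hstep) as [F HF].
  assert (W0 : N) by (exists (fun _ => True); split; auto; apply HTX).
  set (W := nat_rect (fun _ => N) W0 (fun _ w => snd (F w))).
  set (U := fun n => fst (fst (F (W n)))). set (V := fun n => snd (fst (F (W n)))).
  assert (HWUV : forall n,
    TX (U n) /\ TY (V n) /\ (exists x, U n x) /\ (exists y, V n y) /\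
    (forall x, proj1_sig (W (S n)) x -> proj1_sig (W n) x) /\
    (forall x, U n x -> proj1_sig (W n) x) /\
    (forall u v w, U n u -> V n v -> proj1_sig (W (S n)) w ->
       eps / 2 < Rabs (phi u v - phi w v))).
  { intro n. specialize (HF (W n)). unfold U, V.
    change (W (S n)) with (snd (F (W n))).
    destruct (F (W n)) as [[u v] w]; exact HF. }
  assert (Hdecr : forall n k x, proj1_sig (W (k + n)%nat) x -> proj1_sig (W n) x).
  { intros n k; induction k as [|k IH]; intros x Hx; auto.
    apply IH. destruct (HWUV (k + n)%nat) as (_ & _ & _ & _ & Hd & _). apply Hd, Hx. }
  destruct (pseudocompact_product_cluster TX TY U V HTX HTY Hps)
    as (x & y & Hcl); try (intro n; apply HWUV).
  destruct (Hphi x y (eps / 4)) as (A & B & HA & HB & Ax & By & HAB); [lra|].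
  destruct (Hcl A B HA HB Ax By 0%nat) as (n & _ & (u & Uu & Au) & (v & Vv & Bv)).
  destruct (Hcl A B HA HB Ax By (S n)) as (k & Hk & (u' & Uu' & Au') & _).
  (* Since [k > n], the point [u'] lies in [W (S n)], so [phi u v] and [phi u' v] differ by more
     than [eps / 2], although both are within [eps / 4] of [phi x y]. *)
  assert (Hfar : eps / 2 < Rabs (phi u v - phi u' v)).
  { destruct (HWUV n) as (_ & _ & _ & _ & _ & _ & Hfar).
    destruct (HWUV k) as (_ & _ & _ & _ & _ & HU & _).
    apply Hfar; auto. apply (Hdecr (S n) (k - S n)%nat).
    replace (k - S n + S n)%nat with k by lia. auto. }
  pose proof (HAB u v Au Bv) as H1. pose proof (HAB u' v Au' Bv) as H2.
  revert Hfar H1 H2. unfold Rabs. repeat destruct Rcase_abs; lra.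
Qed.

(** * Open factorization of a sequence of real functions *)

Lemma metric_top_is_topology {K : Type} (d : K -> K -> R) :
  is_metric d -> is_topology (metric_top d).
Proof.
  intros _. repeat split.
  - intros x _; exists 1; split; [lra|auto].
  - intros U V HU HV x [Ux Vx].
    destruct (HU x Ux) as (r & Hr & H1), (HV x Vx) as (s & Hs & H2).
    exists (Rmin r s); split; [apply Rmin_pos; auto|].
    intros y Hy; split; [apply H1|apply H2];
      (eapply Rlt_le_trans; [exact Hy|]); [apply Rmin_l|apply Rmin_r].
  - intros F HF x (U & FU & Ux). destruct (HF U FU x Ux) as (r & Hr & H).
    exists r; split; eauto.
Qed.

Lemma metric_ball_open {K : Type} (d : K -> K -> R) (k : K) (r : R) :
  is_metric d -> metric_top d (fun x => d k x < r).
Proof.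
  intros (_ & _ & _ & Htri) x Hx. exists (r - d k x); split; [lra|].
  intros y Hy. specialize (Htri k x y). lra.
Qed.

Lemma inv_S_pos (n : nat) : 0 < / INR (S n).
Proof. apply Rinv_0_lt_compat, lt_0_INR; lia. Qed.

Lemma inv_S_small (eps : R) : 0 < eps ->
  exists N, forall n, (N <= n)%nat -> / INR (S n) < eps.
Proof.
  intro Heps. destruct (archimed_cor1 eps Heps) as (N & HN & Hpos).
  exists N; intros n Hle. eapply Rle_lt_trans; [|exact HN].
  apply Rinv_le_contravar; [apply lt_0_INR; auto|apply le_INR; lia].
Qed.

(** With the [n]-th difference capped at [1/(n+1)], the supremum over [n] depends up to [eps] on
    finitely many coordinates only; so [seq_dist] metrizes pointwise convergence. *)
Definition trunc_diff (s t : nat -> R) (n : nat) : R :=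
  Rmin (Rabs (s n - t n)) (/ INR (S n)).

Lemma trunc_diff_nonneg (s t : nat -> R) (n : nat) : 0 <= trunc_diff s t n.
Proof.
  apply Rmin_glb; [apply Rabs_pos|apply Rlt_le, inv_S_pos].
Qed.

Lemma trunc_diff_bounded (s t : nat -> R) : bound (fun r => exists n, r = trunc_diff s t n).
Proof.
  exists 1. intros r [n ->]. eapply Rle_trans; [apply Rmin_r|].
  rewrite <- Rinv_1. apply Rinv_le_contravar; [lra|].
  change 1 with (INR 1). apply le_INR; lia.
Qed.

Definition seq_dist (s t : nat -> R) : R :=
  proj1_sig (completeness _ (trunc_diff_bounded s t)
    (ex_intro _ _ (ex_intro _ 0%nat eq_refl))).

Lemma trunc_diff_le_dist (s t : nat -> R) (n : nat) : trunc_diff s t n <= seq_dist s t.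
Proof.
  unfold seq_dist. destruct (completeness _ _ _) as [r Hr]. apply Hr; eauto.
Qed.

Lemma seq_dist_le (s t : nat -> R) (r : R) :
  (forall n, trunc_diff s t n <= r) -> seq_dist s t <= r.
Proof.
  intro H. unfold seq_dist. destruct (completeness _ _ _) as [r' Hr'].
  apply Hr'. intros x [n ->]; auto.
Qed.

Lemma seq_dist_metric : is_metric seq_dist.
Proof.
  assert (Hsym : forall s t, seq_dist s t <= seq_dist t s).
  { intros s t; apply seq_dist_le; intro n.
    eapply Rle_trans; [|apply (trunc_diff_le_dist t s n)].
    unfold trunc_diff. rewrite Rabs_minus_sym. lra. }
  split; [|split; [intros s t; split|split]].
  - intros s t. eapply Rle_trans;
      [apply (trunc_diff_nonneg s t 0)|apply trunc_diff_le_dist].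
  - intro H0. apply functional_extensionality; intro n.
    pose proof (trunc_diff_le_dist s t n) as H. rewrite H0 in H.
    unfold trunc_diff, Rmin in H. pose proof (inv_S_pos n).
    destruct Rle_dec; [|lra].
    revert H; unfold Rabs; destruct Rcase_abs; lra.
  - intros ->. apply Rle_antisym.
    + apply seq_dist_le; intro n. unfold trunc_diff.
      eapply Rle_trans; [apply Rmin_l|]. rewrite Rminus_diag, Rabs_R0. lra.
    + eapply Rle_trans;
        [apply (trunc_diff_nonneg t t 0)|apply trunc_diff_le_dist].
  - intros s t. apply Rle_antisym; auto.
  - intros s t u. apply seq_dist_le; intro n.
    eapply Rle_trans; [|apply Rplus_le_compat;
      [apply (trunc_diff_le_dist s t n)|apply (trunc_diff_le_dist t u n)]].
    pose proof (inv_S_pos n). unfold trunc_diff, Rmin, Rabs.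
    repeat destruct Rle_dec; repeat destruct Rcase_abs; lra.
Qed.

(** The functions [phi n] are the coordinates of a map into the metrizable
    space of real sequences; its image is separable because [X] is. *)
Lemma openly_factorizable_sequence {X : Type} (TX : topology X) (z : nat -> X)
    (phi : nat -> X -> R) :
  is_topology TX -> openly_factorizable TX ->
  dense TX (fun x => exists n, z n = x) ->
  (forall n, continuous TX R_top (phi n)) ->
  exists (K : Type) (d : K -> K -> R) (p : X -> K),
    is_metric d /\ continuous TX (metric_top d) p /\ open_map TX (metric_top d) p /\
    (forall x y, p x = p y -> forall n, phi n x = phi n y).
Proof.
  intros HT Hof Hz Hphi.
  set (Y := {s : nat -> R | exists x, s = fun n => phi n x}).
  set (d := fun s t : Y => seq_dist (proj1_sig s) (proj1_sig t)).
  set (f := fun x => exist _ (fun n => phi n x) (ex_intro _ x eq_refl) : Y).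
  assert (Hd : is_metric d).
  { destruct seq_dist_metric as (H1 & H2 & H3 & H4). unfold d.
    split; [|split; [intros s t; split|split]]; auto.
    - intro H. destruct s as [s Hs], t as [t Ht]. apply subset_eq_compat, H2, H.
    - intros ->. apply H2; auto. }
  assert (Hf : continuous TX (metric_top d) f).
  { intros V HV. apply open_of_nbhds; [auto|]. intros x Vx.
    destruct (HV _ Vx) as (eps & Heps & HVeps).
    (* From [N] on the cap is below [eps / 2]; the finitely many earlier coordinates are controlled
       by continuity. *)
    destruct (inv_S_small (eps / 2)) as [N HN]; [lra|].
    destruct (finite_list_inter TX (seq 0 N) x
      (fun n y => Rabs (phi n x - phi n y) < eps / 2) HT) as (U & HU & Ux & HUN).
    { intros n _. exists (fun y => Rabs (phi n x - phi n y) < eps / 2).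
      repeat split; auto.
      - apply (Hphi n (fun r => Rabs (phi n x - r) < eps / 2)).
        intros r Hr. exists (eps / 2 - Rabs (phi n x - r)); split; [lra|].
        intros r' Hr'. revert Hr Hr'. unfold Rabs; repeat destruct Rcase_abs; lra.
      - rewrite Rminus_diag, Rabs_R0. lra. }
    exists U; repeat split; auto. intros y Uy. apply HVeps.
    apply Rle_lt_trans with (eps / 2); [|lra].
    apply seq_dist_le; intro n. simpl. unfold trunc_diff.
    destruct (le_lt_dec N n) as [Hle|Hlt].
    - eapply Rle_trans; [apply Rmin_r|]. apply Rlt_le; auto.
    - eapply Rle_trans; [apply Rmin_l|]. apply Rlt_le, HUN; auto. apply in_seq; lia. }
  destruct (Hof Y (metric_top d)) with (f := f)
    as (K & TK & HTK & (_ & dK & HdK & HKd) & p & g & Hp & Hop & _ & _ & Hfac); auto.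
  - apply metric_top_is_topology; auto.
  - split; [|exists d; split; [auto|tauto]].
    exists (fun y => exists n, y = f (z n)). split.
    + exists (fun n => Some (f (z n))). intros y [n ->]; eauto.
    + intros U HU ([s [x ->]] & Us).
      destruct (Hz _ (Hf U HU)) as (y & Uy & n & <-); [exists x; exact Us|eauto].
  - exists K, dK, p. repeat split; try apply HdK; auto.
    + intros V HV; apply Hp, HKd, HV.
    + intros U HU; apply HKd, Hop, HU.
    + intros x y Hxy n. assert (E : f x = f y) by (rewrite !Hfac, Hxy; auto).
      exact (f_equal (fun s : Y => proj1_sig s n) E).
Qed.

(** If equicontinuity fails at [m], there are bad pairs [(x_n, y_n)] with [p x_n] tending to [p m]
    and [y_n] in [A]. Let [y] be a cluster point of the [y_n]. As [p] is open, [x_n] can be replaced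
    by a point close to [m] with the same image under [p], hence with the same value of [phi] at
    [y_n]; this contradicts joint continuity at [(m, y)]. *)
Lemma openly_factorizable_equicontinuous {X : Type} (TX : topology X) (A : X -> Prop)
    (z : nat -> X) (phi : X -> X -> R) (m : X) :
  is_topology TX -> hausdorff TX -> openly_factorizable TX ->
  (forall x, A x <-> exists n, z n = x) -> dense TX A -> countably_compact_at TX A ->
  (forall n, continuous TX R_top (fun x => phi x (z n))) ->
  jointly_continuous TX TX phi -> equicontinuous_at TX phi m.
Proof.
  intros HT Hh Hof HA Hd Hcc Hsec Hphi eps Heps.
  destruct (openly_factorizable_sequence TX z (fun n x => phi x (z n)) HT Hof)
    as (K & d & p & Hmet & Hp & Hop & Hfac); auto.
  { intros U HU Ue. destruct (Hd U HU Ue) as (x & Ux & Ax). exists x; split; auto.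
    apply HA, Ax. }
  assert (HdK := Hmet). destruct HdK as (_ & Hd0 & _ & _).
  apply NNPP; intro Hn.
  assert (Hbad : forall n, exists xy : X * X,
    d (p m) (p (fst xy)) < / INR (S n) /\ A (snd xy) /\
    eps < Rabs (phi (fst xy) (snd xy) - phi m (snd xy))).
  { intro n. apply NNPP; intro Hc. apply Hn.
    exists (fun x => d (p m) (p x) < / INR (S n)). repeat split.
    - apply (Hp (fun k => d (p m) k < / INR (S n))), metric_ball_open, Hmet.
    - rewrite (proj2 (Hd0 _ _) eq_refl). apply inv_S_pos.
    - intros x y Hx. apply Rnot_lt_le; intro Hlt. apply Hc.
      (* [r] is half the excess over [eps]: moving [y] to a point [v] of the dense set [A] changes
         each of the two values by less than [r]. *)
      set (r := (Rabs (phi x y - phi m y) - eps) / 2).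
      destruct (Hphi x y r) as (A1 & B1 & HA1 & HB1 & A1x & B1y & H1); [unfold r; lra|].
      destruct (Hphi m y r) as (A2 & B2 & HA2 & HB2 & A2m & B2y & H2); [unfold r; lra|].
      destruct (Hd (fun v => B1 v /\ B2 v)) as (v & [B1v B2v] & Av); [|eauto|].
      { apply HT; auto. }
      exists (x, v); simpl. repeat split; auto.
      specialize (H1 x v A1x B1v). specialize (H2 m v A2m B2v).
      revert H1 H2 Hlt. unfold r, Rabs. repeat destruct Rcase_abs; lra. }
  destruct (choice _ Hbad) as [xy Hxy].
  destruct (cluster_of_sequence TX A (fun n => snd (xy n)) HT Hh Hcc) as [y Hy].
  { intro n; apply Hxy. }
  destruct (Hphi m y (eps / 2)) as (U & V & HU & HV & Um & Vy & HUV); [lra|].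
  (* The image of [U] contains a ball around [p m], so [p (fst (xy n))] has a preimage [x'] in [U]
     once [n] is large. *)
  destruct (Hop U HU (p m)) as (r & Hr & Hball); [eauto|].
  destruct (inv_S_small r Hr) as [N HN].
  destruct (Hy V HV Vy N) as (n & Hle & Vn).
  destruct (Hxy n) as (Hx & An & Hfar).
  destruct (Hball (p (fst (xy n)))) as (x' & Ux' & Hpx').
  { eapply Rlt_trans; [exact Hx|auto]. }
  destruct (proj1 (HA _) An) as [k Hk].
  pose proof (Hfac _ _ Hpx' k) as E. simpl in E. rewrite Hk in E.
  pose proof (HUV x' _ Ux' Vn) as H1. pose proof (HUV m _ Um Vn) as H2.
  rewrite E in H1. revert Hfar H1 H2.
  unfold Rabs. repeat destruct Rcase_abs; lra.
Qed.

(** * The bicyclic semigroup *)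

Local Open Scope nat_scope.

Ltac bicyclic_cases :=
  repeat match goal with
  | |- context [Nat.leb ?x ?y] => destruct (Nat.leb_spec x y)
  | H : context [Nat.leb ?x ?y] |- _ => destruct (Nat.leb_spec x y)
  end.

Lemma bmul_assoc : associative bmul.
Proof.
  intros [m n] [i j] [k l]. unfold bmul. bicyclic_cases; f_equal; lia.
Qed.

Lemma bmul_p_q (m n : nat) : bmul (m, 0) (0, n) = (m, n).
Proof. reflexivity. Qed.

Lemma bpow_p (n : nat) : bpow bp n = (n, 0).
Proof.
  induction n as [|n IH]; [reflexivity|].
  change (bmul (bpow bp n) bp = (S n, 0)). rewrite IH. simpl. f_equal; lia.
Qed.

Lemma bpow_q (n : nat) : bpow bq n = (0, n).
Proof.
  induction n as [|n IH]; [reflexivity|].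
  change (bmul (bpow bq n) bq = (0, S n)). rewrite IH. simpl. f_equal; lia.
Qed.

Lemma bmul_eq_one (c d : bicyclic) :
  bmul c d = bone <-> exists n, c = (0, n) /\ d = (n, 0).
Proof.
  destruct c as [m n], d as [i j]. unfold bone; split.
  - unfold bmul. bicyclic_cases; intros [= Hm Hj]; [|lia].
    exists n; split; f_equal; lia.
  - intros (k & [= -> ->] & [= -> ->]). unfold bmul. bicyclic_cases; f_equal; lia.
Qed.

(** This is [q^m p^m q^n p^n = 1]. *)
Lemma bmul_to_one (m n : nat) (c d : bicyclic) :
  bmul c d = (m, n) -> bmul (bmul (0, m) c) (bmul d (n, 0)) = bone.
Proof.
  intro H. rewrite <- bmul_assoc, (bmul_assoc c), H.
  unfold bmul, bone. bicyclic_cases; f_equal; lia.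
Qed.

(** If [p^m q^n p^i q^j = p^k q^r], then [i <= k + n] and [j <= r], which leaves finitely many
    [(i, j)] for each element of [l]. *)
Lemma left_translation_finite_to_one (c : bicyclic) (l : list bicyclic) :
  exists l', forall d, In (bmul c d) l -> In d l'.
Proof.
  destruct c as [m n].
  exists (flat_map (fun f : bicyclic =>
    list_prod (seq 0 (S (fst f + n))) (seq 0 (S (snd f)))) l).
  intros [i j] H. apply in_flat_map. eexists; split; [exact H|].
  apply in_prod; apply in_seq; simpl; bicyclic_cases; simpl; lia.
Qed.

Lemma right_translation_finite_to_one (c : bicyclic) (l : list bicyclic) :
  exists l', forall d, In (bmul d c) l -> In d l'.
Proof.
  destruct c as [m n].
  exists (flat_map (fun f : bicyclic =>
    list_prod (seq 0 (S (fst f))) (seq 0 (S (snd f + m)))) l).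
  intros [i j] H. apply in_flat_map. eexists; split; [exact H|].
  apply in_prod; apply in_seq; simpl; bicyclic_cases; simpl; lia.
Qed.

(** * Powers *)

Lemma npow_succ_l {X : Type} (mul : X -> X -> X) (e x : X) (n : nat) :
  associative mul -> (forall y, mul e y = y) -> (forall y, mul y e = y) ->
  npow mul e x (S n) = mul x (npow mul e x n).
Proof.
  intros mulA mul1l mul1r. induction n as [|n IH]; simpl in *.
  - rewrite mul1l, mul1r; auto.
  - rewrite IH at 1. symmetry; apply mulA.
Qed.

Lemma npow_inverse {X : Type} (mul : X -> X -> X) (e x y : X) (n : nat) :
  associative mul -> (forall z, mul e z = z) -> (forall z, mul z e = z) ->
  mul x y = e -> mul (npow mul e x n) (npow mul e y n) = e.
Proof.
  intros mulA mul1l mul1r Hxy. induction n as [|n IH]; [apply mul1l|].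
  rewrite (npow_succ_l mul e y); auto. simpl.
  rewrite <- mulA, (mulA x), Hxy, mul1l; auto.
Qed.

Lemma npow_commute {X : Type} (mul : X -> X -> X) (e x y : X) (n : nat) :
  associative mul -> (forall z, mul e z = z) -> (forall z, mul z e = z) ->
  mul x y = mul y x -> mul x (npow mul e y n) = mul (npow mul e y n) x.
Proof.
  intros mulA mul1l mul1r Hxy. induction n as [|n IH]; simpl.
  - rewrite mul1l, mul1r; auto.
  - rewrite mulA, IH, <- mulA, Hxy, mulA; auto.
Qed.

Section CommutativeMonoid.

Context {M : Type} (mul : M -> M -> M) (e : M).
Context (mulA : associative mul).
Context (mul1 : forall x, mul e x = x).
Context (mulC : forall x y, mul x y = mul y x).

Lemma mul_e_r (x : M) : mul x e = x.
Proof. rewrite mulC; apply mul1. Qed.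

Lemma mulACA (x y z t : M) : mul (mul x y) (mul z t) = mul (mul x z) (mul y t).
Proof. rewrite <- !mulA, (mulA y), (mulC y z), <- mulA; auto. Qed.

Lemma npow_add (x : M) (n k : nat) :
  npow mul e x (n + k) = mul (npow mul e x n) (npow mul e x k).
Proof.
  induction k as [|k IH].
  - rewrite Nat.add_0_r; symmetry; apply mul_e_r.
  - rewrite Nat.add_succ_r; simpl. rewrite IH; symmetry; apply mulA.
Qed.

Lemma npow_unit (n : nat) : npow mul e e n = e.
Proof. induction n as [|n IH]; simpl; rewrite ?IH; auto. Qed.

Lemma npow_mul (x y : M) (n : nat) :
  npow mul e (mul x y) n = mul (npow mul e x n) (npow mul e y n).
Proof.
  induction n as [|n IH]; simpl; [symmetry; apply mul1|].
  rewrite IH; apply mulACA.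
Qed.

Lemma npow_npow (x : M) (i n : nat) :
  npow mul e (npow mul e x i) n = npow mul e (npow mul e x n) i.
Proof.
  induction i as [|i IH]; simpl; [apply npow_unit|].
  rewrite npow_mul, IH; auto.
Qed.

Lemma npow_sub (x y : M) (n k : nat) :
  mul x y = e -> mul (npow mul e x (n + k)) (npow mul e y n) = npow mul e x k.
Proof.
  intro Hxy. rewrite Nat.add_comm, npow_add, <- mulA.
  rewrite npow_inverse; auto using mul_e_r.
Qed.

Lemma npow_injective (x y : M) (n k : nat) :
  mul x y = e -> (forall j, npow mul e x (S j) <> e) ->
  npow mul e x n = npow mul e x k -> n = k.
Proof.
  intros Hxy Hinf.
  assert (Hlt : forall n k, npow mul e x n = npow mul e x k -> ~ n < k).
  { intros i j H Hij. apply (Hinf (j - i - 1)).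
    rewrite <- (npow_sub x y i) by auto.
    replace (i + S (j - i - 1)) with j by lia.
    rewrite <- H. apply npow_inverse; auto using mul_e_r. }
  intro H. pose proof (Hlt n k H). pose proof (Hlt k n (eq_sym H)). lia.
Qed.

End CommutativeMonoid.

(** * Translations in a topological semigroup *)

Lemma left_translation_continuous {M : Type} (TM : topology M) (mul : M -> M -> M) (x : M) :
  is_topology TM -> topological_semigroup TM mul -> continuous TM TM (mul x).
Proof.
  intros HT [_ Hc] V HV. apply open_of_nbhds; auto. intros y Vy.
  destruct (Hc x y V HV Vy) as (U & W & HU & HW & Ux & Wy & HUW). eauto.
Qed.

Lemma right_translation_continuous {M : Type} (TM : topology M) (mul : M -> M -> M) (x : M) :
  is_topology TM -> topological_semigroup TM mul -> continuous TM TM (fun y => mul y x).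
Proof.
  intros HT [_ Hc] V HV. apply open_of_nbhds; auto. intros y Vy.
  destruct (Hc y x V HV Vy) as (U & W & HU & HW & Ux & Wy & HUW). eauto.
Qed.

Lemma identity_continuous {X : Type} (T : topology X) : continuous T T (fun x => x).
Proof. intros V HV; exact HV. Qed.

(** An idempotent of the group [Z] is its unit; hence [pi q] and [pi p] are
    mutually inverse, their powers exhaust [Z], and the identities valid in [Z]
    extend to [M] by density. *)
Lemma dense_cyclic_image {M : Type} (TM : topology M) (mul : M -> M -> M)
    (pi : bicyclic -> M) :
  is_topology TM -> hausdorff TM -> topological_semigroup TM mul ->
  (forall c d, pi (bmul c d) = mul (pi c) (pi d)) ->
  infinite_cyclic_subgroup mul (fun m => exists c, pi c = m) ->
  dense TM (fun m => exists c, pi c = m) ->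
  exists e, (forall x, mul e x = x) /\ (forall x y, mul x y = mul y x) /\
    mul (pi bq) (pi bp) = e /\
    (forall n, npow mul e (pi bq) (S n) <> e) /\
    (forall m n, pi (m, n) = mul (npow mul e (pi bp) m) (npow mul e (pi bq) n)).
Proof.
  intros HT Hh Hsg Hhom (e & g & h & Hee & Heg & Hge & Heh & Hhe & Hgh & Hhg & HZ & Hg) Hd.
  assert (mulA : associative mul) by apply Hsg.
  pose proof (fun x => left_translation_continuous TM mul x HT Hsg) as HL.
  pose proof (fun x => right_translation_continuous TM mul x HT Hsg) as HR.
  (* So far [e] is neutral only for [g] and [h]; it has to be neutral for their powers before
     density can make it the unit of [M]. *)
  assert (Hel : forall x n, mul e x = x -> mul e (npow mul e x n) = npow mul e x n).
  { intros x n Hx. destruct n as [|n]; auto. induction n as [|n IH]; simpl.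
    - rewrite mulA, Hee; auto.
    - simpl in IH. rewrite mulA, IH; auto. }
  assert (Her : forall x n, mul x e = x -> mul (npow mul e x n) e = npow mul e x n).
  { intros x n Hx. destruct n as [|n]; auto. simpl. rewrite <- mulA, Hx; auto. }
  assert (mul1l : forall x, mul e x = x).
  { apply (continuous_eq_on_dense TM TM _ (mul e) (fun x => x) HT Hh Hd);
      auto using identity_continuous.
    intros x Zx. apply HZ in Zx. destruct Zx as (n & [->| ->]); auto. }
  assert (mul1r : forall x, mul x e = x).
  { apply (continuous_eq_on_dense TM TM _ (fun x => mul x e) (fun x => x) HT Hh Hd);
      auto using identity_continuous.
    intros x Zx. apply HZ in Zx. destruct Zx as (n & [->| ->]); auto. }
  (* Multiplying [pi c = pi c * pi c] by an inverse [z] of [pi c] gives [e]. *)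
  assert (Hidem : forall c, mul (pi c) (pi c) = pi c -> pi c = e).
  { intros c Hc. destruct (proj1 (HZ (pi c))) as (n & Hn); [eauto|].
    assert (Hinv : exists z, mul (pi c) z = e).
    { destruct Hn as [->| ->]; eexists; apply npow_inverse; eauto. }
    destruct Hinv as [z Hz]. rewrite <- (mul1r (pi c)), <- Hz at 1.
    rewrite mulA, Hc; auto. }
  assert (Hone : pi bone = e) by (apply Hidem; rewrite <- Hhom; reflexivity).
  assert (Hqp : mul (pi bq) (pi bp) = e) by (rewrite <- Hhom; exact Hone).
  (* [pq] is an idempotent other than [1] in the bicyclic semigroup, but its image in the group can
     only be [e]. *)
  assert (Hpq : mul (pi bp) (pi bq) = e).
  { rewrite <- Hhom. apply Hidem. rewrite <- Hhom; reflexivity. }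
  assert (Hpi : forall m n,
    pi (m, n) = mul (npow mul e (pi bp) m) (npow mul e (pi bq) n)).
  { intros m n. rewrite <- bmul_p_q, Hhom, <- bpow_p, <- bpow_q. f_equal.
    - induction m as [|m IH]; [exact Hone|]. simpl. rewrite <- IH. apply Hhom.
    - induction n as [|n IH]; [exact Hone|]. simpl. rewrite <- IH. apply Hhom. }
  assert (Hcomm : forall x, mul x (pi bp) = mul (pi bp) x ->
    mul x (pi bq) = mul (pi bq) x -> forall c, mul x (pi c) = mul (pi c) x).
  { intros x Hxp Hxq [m n]. rewrite Hpi.
    rewrite mulA, (npow_commute mul e x (pi bp)), <- mulA, (npow_commute mul e x (pi bq)), mulA; auto. }
  assert (HcommZ : forall c d, mul (pi c) (pi d) = mul (pi d) (pi c)).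
  { intro c. apply Hcomm; symmetry; apply Hcomm; congruence. }
  assert (mulC : forall x y, mul x y = mul y x).
  (* Density is used twice: first for one factor in [Z], then for an arbitrary one. *)
  { assert (H1 : forall c y, mul (pi c) y = mul y (pi c)).
    { intro c. apply (continuous_eq_on_dense TM TM _ (mul (pi c))
        (fun y => mul y (pi c)) HT Hh Hd); auto. intros y [d <-]; auto. }
    intro x. apply (continuous_eq_on_dense TM TM _ (mul x) (fun y => mul y x) HT Hh Hd);
      auto. intros y [d <-]; symmetry; auto. }
  exists e; repeat split; auto.
  intros n Hn.
  (* If [pi q] had finite order, so would its inverse [pi p], and then also the generator [g], which
     is a product of powers of the two. *)
  destruct (proj2 (HZ g)) as [[i j] Hij].
  { exists 1; left; simpl; auto. }
  assert (Hp : npow mul e (pi bp) (S n) = e).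
  { transitivity (mul (npow mul e (pi bq) (S n)) (npow mul e (pi bp) (S n))).
    - rewrite Hn; symmetry; apply mul1l.
    - apply npow_inverse; auto. }
  apply (Hg n). rewrite <- Hij, Hpi, npow_mul; auto.
  rewrite (npow_npow mul e mulA mul1l mulC (pi bp) i (S n)).
  rewrite (npow_npow mul e mulA mul1l mulC (pi bq) j (S n)).
  rewrite Hn, Hp, !npow_unit; auto.
Qed.

(** * The space [C(p,q) \cup_pi M] *)

(** Points of the bicyclic semigroup are isolated, so openness is tested at points of [M] only; the
    list [l] is the finite set missed by a neighbourhood of infinity. *)
Lemma S_topE {M : Type} (TM : topology M) (pi : bicyclic -> M) (O : Sunion M -> Prop) :
  is_topology TM ->
  (S_top TM pi O <-> forall m, O (inr m) -> exists V (l : list bicyclic),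
     TM V /\ V m /\ (forall y, V y -> O (inr y)) /\
     (forall c, V (pi c) -> ~ In c l -> O (inl c))).
Proof.
  intro HT; split.
  - intros (W & HW & HOW) m Om.
    destruct (HW (None, m)) as (U & V & HU & HV & Um & Vm & HUV); [exact (proj1 (HOW (inr m)) Om)|].
    destruct (HU Um) as [l Hl].
    exists V, l; repeat split; auto.
    + intros y Vy. apply HOW, HUV; auto.
    + intros c Vc Hc. apply HOW, HUV; auto. apply NNPP; intro; apply Hc, Hl; auto.
  - intro H.
    (* The witness is the union of all open boxes whose trace on [S] lies in [O]. *)
    exists (fun z => exists U V, alpha_top bicyclic U /\ TM V /\ U (fst z) /\ V (snd z) /\
      forall s, U (fst (S_embed pi s)) -> V (snd (S_embed pi s)) -> O s).
    split.
    + intros z (U & V & HU & HV & Uz & Vz & HUV). exists U, V; repeat split; auto.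
      intros a b Ua Vb. exists U, V; auto 10.
    + intro s; split.
      * destruct s as [c|m]; intro Os.
        -- exists (fun o => o = Some c), (fun _ => True). repeat split; auto.
           ++ intro Hc; discriminate Hc.
           ++ apply HT.
           ++ intros [d|y]; simpl; congruence.
        -- destruct (H m Os) as (V & l & HV & Vm & HVr & HVl).
           exists (fun o => forall c, o = Some c -> ~ In c l), V. repeat split; auto.
           ++ intros _. exists l. intros c Hc. apply NNPP; intro Hcl. apply Hc.
              intros d [= <-]; auto.
           ++ intros c Hc; discriminate Hc.
           ++ intros [d|y]; simpl; auto.
      * intros (U & V & _ & _ & Us & Vs & HUV); auto.
Qed.

Lemma S_top_is_topology {M : Type} (TM : topology M) (pi : bicyclic -> M) :
  is_topology TM -> is_topology (S_top TM pi).
Proof.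
  intro HT. split; [|split].
  - apply S_topE; auto. intros m _. exists (fun _ => True), nil; repeat split; auto. apply HT.
  - intros U V HU HV. apply S_topE; auto. intros m [Um Vm].
    destruct (proj1 (S_topE TM pi U HT) HU m Um) as (U1 & l1 & H1 & U1m & Hr1 & Hl1).
    destruct (proj1 (S_topE TM pi V HT) HV m Vm) as (V1 & l2 & H2 & V1m & Hr2 & Hl2).
    exists (fun y => U1 y /\ V1 y), (l1 ++ l2). split; [apply HT; auto|].
    split; [auto|]. split; [firstorder|].
    intros c [Uc Vc] Hc. rewrite in_app_iff in Hc. split; [apply Hl1|apply Hl2]; tauto.
  - intros F HF. apply S_topE; auto. intros m (U & FU & Um).
    destruct (proj1 (S_topE TM pi U HT) (HF U FU) m Um) as (U1 & l1 & H1 & U1m & Hr1 & Hl1).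
    exists U1, l1; repeat split; eauto.
Qed.

Lemma S_top_singleton {M : Type} (TM : topology M) (pi : bicyclic -> M) (c : bicyclic) :
  is_topology TM -> S_top TM pi (fun s => s = inl c).
Proof. intro HT. apply S_topE; auto. intros m Hm; discriminate Hm. Qed.

Lemma S_top_cosingleton {M : Type} (TM : topology M) (pi : bicyclic -> M) (c : bicyclic) :
  is_topology TM -> S_top TM pi (fun s => s <> inl c).
Proof.
  intro HT. apply S_topE; auto. intros m _. exists (fun _ => True), (c :: nil).
  repeat split; try discriminate; [apply HT|].
  intros d _ Hd [= ->]. apply Hd; left; auto.
Qed.

(** [snd (S_embed pi s)] is the retraction of [S] onto [M] extending [pi]; the basic neighbourhoods
    of points of [M] are preimages of open sets under it, minus finitely many bicyclic elements. *)
Definition S_nbhd {M : Type} (pi : bicyclic -> M) (V : M -> Prop) (l : list bicyclic)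
    (s : Sunion M) : Prop :=
  V (snd (S_embed pi s)) /\ forall c, s = inl c -> ~ In c l.

Lemma S_nbhd_open {M : Type} (TM : topology M) (pi : bicyclic -> M) (V : M -> Prop)
    (l : list bicyclic) :
  is_topology TM -> TM V -> S_top TM pi (S_nbhd pi V l).
Proof.
  intros HT HV. apply S_topE; auto. intros m [Vm _]. exists V, l; repeat split; auto.
  - discriminate.
  - intros d [= <-]; auto.
Qed.

(** A cluster point [m] of the image of [B] under the retraction works in [S]: infinitely many
    points of [B] retract into each neighbourhood of [m], so one remains after discarding [l] and
    [m] itself. *)
Lemma S_countably_compact {M : Type} (TM : topology M) (pi : bicyclic -> M) :
  is_topology TM -> hausdorff TM -> countably_compact TM ->
  countably_compact (S_top TM pi).
Proof.
  intros HT Hh Hcc B _ HB.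
  destruct (cluster_of_infinite TM _ (fun s => snd (S_embed pi s)) B HT Hh Hcc)
    as [m Hm]; auto.
  exists (inr m). intros U HU Um.
  destruct (proj1 (S_topE TM pi U HT) HU m Um) as (V & l & HV & Vm & Hr & Hl).
  destruct (infinite_not_in_list _ (inr m :: map inl l) (Hm V HV Vm))
    as (s & [Bs Vs] & Hs).
  exists s; repeat split; auto.
  - destruct s as [c|y]; simpl in *; auto. apply Hl; auto.
    intro Hc; apply Hs; right; apply in_map, Hc.
  - intros ->; apply Hs; left; auto.
Qed.

Definition factorizations {M : Type} (c : bicyclic) (z : Sunion M * Sunion M) : Prop :=
  exists x y, z = (inl x, inl y) /\ bmul x y = c.

(** As [M] is an ideal of [S], this set is the whole preimage of the closed point [c] under the
    multiplication. *)
Lemma factorizations_closed {M : Type} (TM : topology M) (mul : M -> M -> M)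
    (pi : bicyclic -> M) (c : bicyclic) :
  is_topology TM -> topological_semigroup (S_top TM pi) (S_mul mul pi) ->
  closed (product_top (S_top TM pi) (S_top TM pi)) (factorizations c).
Proof.
  intros HT [_ HS] [s t] Hst.
  destruct (HS s t (fun r => r <> inl c)) as (U & V & HU & HV & Us & Vt & HUV).
  - apply S_top_cosingleton; auto.
  - intro H. apply Hst. destruct s as [x|x], t as [y|y]; try discriminate H.
    exists x, y; split; [auto|injection H; auto].
  - exists U, V; repeat split; auto. intros a b Ua Vb (x & y & [= -> ->] & Hxy).
    apply (HUV _ _ Ua Vb). simpl; congruence.
Qed.

(** The isolated points [(q^n, p^n)] are exactly the factorizations of [1]. They cannot cluster
    outside this set because it is closed, nor inside because each is isolated. *)
Lemma factorizations_of_one_not_pseudocompact {M : Type} (TM : topology M)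
    (pi : bicyclic -> M) :
  is_topology TM ->
  closed (product_top (S_top TM pi) (S_top TM pi)) (factorizations bone) ->
  ~ pseudocompact (product_top (S_top TM pi) (S_top TM pi)).
Proof.
  intros HT Hcl Hps.
  destruct (pseudocompact_product_cluster (S_top TM pi) (S_top TM pi)
    (fun n s => s = inl (0, n)) (fun n s => s = inl (n, 0))) as (s & t & Hst);
    eauto using S_top_is_topology, S_top_singleton.
  destruct (classic (factorizations bone (s, t))) as [(x & y & [= -> ->] & Hxy)|Hn].
  - apply bmul_eq_one in Hxy. destruct Hxy as (k & -> & ->).
    destruct (Hst (fun s => s = inl (0, k)) (fun s => s = inl (k, 0))) with (N := S k)
      as (n & Hn & (u & -> & Hu) & _); auto using S_top_singleton.
    injection Hu; lia.
  - destruct (Hcl (s, t) Hn) as (U & V & HU & HV & Us & Vt & HUV).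
    destruct (Hst U V HU HV Us Vt 0) as (n & _ & (u & -> & Uu) & (v & -> & Vv)).
    apply (HUV _ _ Uu Vv). exists (0, n), (n, 0); split; auto.
    apply bmul_eq_one; eauto.
Qed.

Lemma S_mul_assoc {M : Type} (mul : M -> M -> M) (pi : bicyclic -> M) :
  associative mul -> (forall c d, pi (bmul c d) = mul (pi c) (pi d)) ->
  associative (S_mul mul pi).
Proof.
  intros mulA Hhom [x|x] [y|y] [z|z]; simpl;
    rewrite ?bmul_assoc, ?Hhom, ?mulA; auto.
Qed.

(** * The sequence [(pi q^n, pi p^n)] *)

Definition inverse_powers_locally_finite {M : Type} (TM : topology M)
    (mul : M -> M -> M) (e a b : M) : Prop :=
  forall x y, exists U V N, TM U /\ TM V /\ U x /\ V y /\
    forall n, U (npow mul e a n) -> V (npow mul e b n) -> n < N.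

Section BicyclicImage.

Context {M : Type} (TM : topology M) (mul : M -> M -> M) (e : M) (pi : bicyclic -> M).
Context (HT : is_topology TM).
Context (Hh : hausdorff TM).
Context (Hsg : topological_semigroup TM mul).
Context (Hhom : forall c d, pi (bmul c d) = mul (pi c) (pi d)).
Context (mul1 : forall x, mul e x = x).
Context (mulC : forall x y, mul x y = mul y x).
Context (Hqp : mul (pi bq) (pi bp) = e).
Context (Hinf : forall n, npow mul e (pi bq) (S n) <> e).
Context (Hpi : forall m n,
  pi (m, n) = mul (npow mul e (pi bp) m) (npow mul e (pi bq) n)).

Local Notation q_ n := (npow mul e (pi bq) n).
Local Notation p_ n := (npow mul e (pi bp) n).
Local Notation locally_finite_powers :=
  (inverse_powers_locally_finite TM mul e (pi bq) (pi bp)).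

Let mulA : associative mul := proj1 Hsg.

Lemma pi_q (n : nat) : pi (0, n) = q_ n.
Proof. rewrite Hpi; apply mul1. Qed.

Lemma pi_p (n : nat) : pi (n, 0) = p_ n.
Proof. rewrite Hpi; apply (mul_e_r mul e mul1 mulC). Qed.

Lemma mul_q_p (n : nat) : mul (q_ n) (p_ n) = e.
Proof. apply npow_inverse; auto. apply (mul_e_r mul e mul1 mulC). Qed.

Lemma q_injective (n k : nat) : q_ n = q_ k -> n = k.
Proof. exact (npow_injective mul e mulA mul1 mulC _ _ n k Hqp Hinf). Qed.

(** Only terms with [n < N] are left near [(x, y)]; Hausdorffness removes those first coordinates
    that differ from [x] and those second ones that differ from [y]. *)
Lemma locally_finite_separated : locally_finite_powers ->
  forall x y, exists U V, TM U /\ TM V /\ U x /\ V y /\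
    forall n, U (q_ n) -> V (p_ n) -> q_ n = x /\ p_ n = y.
Proof.
  intros H x y. destruct (H x y) as (U & V & N & HU & HV & Ux & Vy & HN).
  destruct (open_avoiding_list TM (map (fun n => q_ n) (seq 0 N)) x U HT Hh HU Ux)
    as (U' & HU' & U'x & HUU' & HU'l).
  destruct (open_avoiding_list TM (map (fun n => p_ n) (seq 0 N)) y V HT Hh HV Vy)
    as (V' & HV' & V'y & HVV' & HV'l).
  exists U', V'; repeat split; auto;
    [apply HU'l|apply HV'l]; auto; apply (in_map (fun n => _ n)), in_seq;
    split; try lia; apply HN; auto.
Qed.

(** For the converse, closedness handles points off the set and discreteness isolates a single term
    at points of it; injectivity of the powers turns a single term into a single index. *)
Lemma locally_finite_iff_closed_discrete :
  locally_finite_powers <->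
  closed (product_top TM TM)
    (fun z => exists n, z = (pi (bpow bq n), pi (bpow bp n))) /\
  discrete_set (product_top TM TM)
    (fun z => exists n, z = (pi (bpow bq n), pi (bpow bp n))).
Proof.
  assert (E : forall n, (pi (bpow bq n), pi (bpow bp n)) = (q_ n, p_ n)).
  { intro n. rewrite bpow_q, bpow_p, pi_q, pi_p; auto. }
  split.
  - intro H. pose proof (locally_finite_separated H) as Hs. split.
    + intros [x y] Hxy. destruct (Hs x y) as (U & V & HU & HV & Ux & Vy & HUV).
      exists U, V; repeat split; auto. intros u v Uu Vv [n Hn].
      apply Hxy. exists n. rewrite E in *. injection Hn as -> ->.
      destruct (HUV n Uu Vv); simpl; congruence.
    + intros [x y] _. destruct (Hs x y) as (U & V & HU & HV & Ux & Vy & HUV).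
      exists (fun z => U (fst z) /\ V (snd z)).
      split; [apply open_box; auto|]. split; [auto|].
      intros z [n ->] [Uu Vv]. rewrite E in *. destruct (HUV n Uu Vv); congruence.
  - intros [Hcl Hdis] x y.
    destruct (classic (exists n, (x, y) = (pi (bpow bq n), pi (bpow bp n))))
      as [[k Hk]|Hn].
    + destruct (Hdis (x, y)) as (W & HW & Wxy & HWd); [eauto|].
      destruct (HW _ Wxy) as (U & V & HU & HV & Ux & Vy & HUV).
      exists U, V, (S k); repeat split; auto. intros n Un Vn.
      assert (Heq : (q_ n, p_ n) = (x, y)).
      { apply HWd; [exists n; rewrite E|]; auto. }
      rewrite Hk, E in Heq. injection Heq as Hq _. apply q_injective in Hq; lia.
    + destruct (Hcl (x, y) Hn) as (U & V & HU & HV & Ux & Vy & HUV).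
      exists U, V, 0; repeat split; auto. intros n Un Vn.
      destruct (HUV _ _ Un Vn). exists n; auto.
Qed.

Lemma closed_factorizations_locally_finite :
  closed (product_top (S_top TM pi) (S_top TM pi)) (factorizations bone) ->
  locally_finite_powers.
Proof.
  intros Hcl x y.
  destruct (Hcl (inr x, inr y)) as (U & V & HU & HV & Ux & Vy & HUV).
  { intros (c & d & H & _); discriminate H. }
  destruct (proj1 (S_topE TM pi U HT) HU x Ux) as (U1 & l1 & HU1 & U1x & _ & Hl1).
  destruct (proj1 (S_topE TM pi V HT) HV y Vy) as (V1 & l2 & HV1 & V1y & _ & Hl2).
  (* For [n >= N] neither [q^n] lies in [l1] nor [p^n] in [l2]. *)
  destruct (list_nat_bound (map snd l1 ++ map fst l2)) as [N HN].
  exists U1, V1, N; repeat split; auto. intros n Un Vn.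
  destruct (le_lt_dec N n) as [Hle|]; auto. exfalso.
  apply (HUV (inl (0, n)) (inl (n, 0))).
  - apply Hl1; [rewrite pi_q; auto|]. intro Hin.
    apply (in_map snd) in Hin. specialize (HN n).
    rewrite in_app_iff in HN. apply (Nat.lt_irrefl n), (Nat.lt_le_trans _ N); auto.
  - apply Hl2; [rewrite pi_p; auto|]. intro Hin.
    apply (in_map fst) in Hin. specialize (HN n).
    rewrite in_app_iff in HN. apply (Nat.lt_irrefl n), (Nat.lt_le_trans _ N); auto.
  - exists (0, n), (n, 0); split; auto. apply bmul_eq_one; eauto.
Qed.

(** If [cd = p^m q^n] then [(q^m c)(d p^n) = 1], so that [q^m c = q^k] and
    [d p^n = p^k] for some [k]. *)
Lemma locally_finite_factorizations (f : bicyclic) (x y : M) :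
  locally_finite_powers ->
  exists U V l, TM U /\ TM V /\ U x /\ V y /\
    forall c d, U (pi c) -> V (pi d) -> ~ In c l -> bmul c d <> f.
Proof.
  destruct f as [m n]. intro H.
  destruct (H (mul (q_ m) x) (mul y (p_ n))) as (U & V & N & HU & HV & Ux & Vy & HN).
  (* The exceptional [c] are those with [q^m c = q^k] for some [k < N]. *)
  destruct (left_translation_finite_to_one (0, m) (map (fun k => (0, k)) (seq 0 N)))
    as [l Hl].
  exists (fun z => U (mul (q_ m) z)), (fun z => V (mul z (p_ n))), l.
  repeat split; auto.
  - apply left_translation_continuous; auto.
  - apply (right_translation_continuous TM mul (p_ n)); auto.
  - intros c d Uc Vd Hc Hcd. apply Hc, Hl.
    apply bmul_to_one, bmul_eq_one in Hcd. destruct Hcd as (k & Hk1 & Hk2).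
    rewrite Hk1. apply (in_map (fun k => (0, k))), in_seq. split; [lia|].
    apply HN; [rewrite <- pi_q, <- Hk1, Hhom, pi_q|rewrite <- pi_p, <- Hk2, Hhom, pi_p];
      auto.
Qed.

(** If one factor is bicyclic, it is isolated, and finite-to-one translations suffice. Local
    finiteness enters at pairs of points of [M], where products of nearby bicyclic elements must
    avoid the finite list [l]. *)
Lemma locally_finite_topological_semigroup :
  locally_finite_powers -> topological_semigroup (S_top TM pi) (S_mul mul pi).
Proof.
  intro HLF. split; [apply S_mul_assoc; auto|].
  intros [c|x] [d|y] O HO Ost.
  - exists (fun s => s = inl c), (fun s => s = inl d).
    repeat split; auto using S_top_singleton. intros a b -> ->; exact Ost.
  - destruct (proj1 (S_topE TM pi O HT) HO _ Ost) as (V & l & HV & Vm & Hr & Hl).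
    destruct (left_translation_finite_to_one c l) as [l' Hl'].
    exists (fun s => s = inl c), (S_nbhd pi (fun z => V (mul (pi c) z)) l').
    repeat split; auto using S_top_singleton; try discriminate.
    + apply S_nbhd_open; auto. apply left_translation_continuous; auto.
    + intros s t -> [Vt Ht]. destruct t as [d|z]; simpl in *; auto.
      apply Hl; [rewrite Hhom; auto|]. intro Hin; apply (Ht d); auto.
  - destruct (proj1 (S_topE TM pi O HT) HO _ Ost) as (V & l & HV & Vm & Hr & Hl).
    destruct (right_translation_finite_to_one d l) as [l' Hl'].
    exists (S_nbhd pi (fun z => V (mul z (pi d))) l'), (fun s => s = inl d).
    repeat split; auto using S_top_singleton; try discriminate.
    + apply S_nbhd_open; auto. apply (right_translation_continuous TM mul (pi d)); auto.
    + intros s t [Vs Hs] ->. destruct s as [c|z]; simpl in *; auto.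
      apply Hl; [rewrite Hhom; auto|]. intro Hin; apply (Hs c); auto.
  - destruct (proj1 (S_topE TM pi O HT) HO _ Ost) as (V & l & HV & Vm & Hr & Hl).
    destruct (proj2 Hsg x y V HV Vm) as (U1 & W1 & HU1 & HW1 & U1x & W1y & HUW).
    (* The elements of [l] are avoided one at a time; excluding finitely many first factors is
       enough. *)
    assert (Hav : exists U W l', TM U /\ TM W /\ U x /\ W y /\
      forall c d, U (pi c) -> W (pi d) -> ~ In c l' -> ~ In (bmul c d) l).
    { clear Hl. induction l as [|f l (U & W & l' & HU & HW & Ux & Wy & IH)].
      - exists (fun _ => True), (fun _ => True), nil.
        repeat split; auto; apply HT.
      - destruct (locally_finite_factorizations f x y HLF)
          as (U2 & W2 & l2 & HU2 & HW2 & U2x & W2y & H2).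
        exists (fun z => U z /\ U2 z), (fun z => W z /\ W2 z), (l' ++ l2).
        repeat split; auto; try (apply HT; auto).
        intros c d [Uc U2c] [Wd W2d] Hc [E|Hin]; rewrite in_app_iff in Hc.
        + apply (H2 c d); auto.
        + apply (IH c d); auto. }
    destruct Hav as (U & W & l' & HU & HW & Ux & Wy & Hav).
    exists (S_nbhd pi (fun z => U1 z /\ U z) l'), (S_nbhd pi (fun z => W1 z /\ W z) nil).
    repeat split; auto; try discriminate;
      try (apply S_nbhd_open; auto; apply HT; auto).
    intros [c|u] [d|w] [[U1u Uu] Hs] [[W1w Ww] _]; simpl in *; auto.
    apply Hl; [rewrite Hhom; auto|]. apply Hav; auto.
Qed.

(** If [x] is in [Z], discreteness isolates it from all other powers of [pi q]. If not, neither is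
    [x y], so [x y] differs from [e], while every [(q_ n) (p_ n)] equals [e]. *)
Lemma discrete_ideal_locally_finite :
  discrete_set TM (fun m => exists c, pi c = m) ->
  ideal mul (fun m => ~ exists c, pi c = m) ->
  locally_finite_powers.
Proof.
  intros Hdis [_ Hid] x y.
  destruct (classic (exists c, pi c = x)) as [Zx|Nx].
  - destruct (Hdis x Zx) as (U & HU & Ux & HUx).
    assert (Hq : forall n, U (q_ n) -> q_ n = x).
    { intros n Un; apply HUx; auto. exists (0, n). apply pi_q. }
    destruct (classic (exists k, q_ k = x)) as [[k Hk]|Hk].
    + exists U, (fun _ => True), (S k). repeat split; auto; [apply HT|].
      intros n Un _. assert (q_ n = q_ k) as ->%q_injective; [|lia].
      rewrite Hk; auto.
    + exists U, (fun _ => True), 0. repeat split; auto; [apply HT|].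
      intros n Un _. destruct Hk; eauto.
  - assert (Hne : mul x y <> e).
    { intro E. apply (proj1 (Hid x y Nx)). exists (0, 0). rewrite pi_q; auto. }
    destruct (Hh _ _ Hne) as (A & B & HA & HB & Axy & Be & HAB).
    destruct (proj2 Hsg x y A HA Axy) as (U & V & HU & HV & Ux & Vy & HUV).
    exists U, V, 0. repeat split; auto. intros n Un Vn.
    destruct (HAB e); auto. rewrite <- (mul_q_p n); auto.
Qed.

(** * Obstructions to compactness-type properties of [M] *)

Lemma locally_finite_unit_nbhd : locally_finite_powers ->
  exists U, TM U /\ U e /\ forall n, U (q_ n) -> U (p_ n) -> n = 0.
Proof.
  intro H. destruct (locally_finite_separated H e e) as (U & V & HU & HV & Ue & Ve & HUV).
  exists (fun x => U x /\ V x). split; [apply HT; auto|]. split; [auto|].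
  intros n [Un _] [_ Vn]. apply q_injective, HUV; auto.
Qed.

Lemma no_equicontinuous_translates (A : M -> Prop) :
  locally_finite_powers -> tychonoff TM ->
  (forall n, A (q_ n)) -> countably_compact_at TM A ->
  (forall phi, continuous TM R_top phi ->
     forall m, equicontinuous_at TM (fun x y => phi (mul x y)) m) -> False.
Proof.
  intros HLF [_ Htych] HA Hcc Heq.
  destruct (locally_finite_unit_nbhd HLF) as (U & HU & Ue & HUn).
  destruct (Htych (fun x => ~ U x) e) as (phi & Hphi & Hphi0 & Hphi1); auto.
  { apply (open_ext TM U); auto. intro x; split; [auto|apply NNPP]. }
  assert (HphiU : forall x, (Rabs (phi x) < 1)%R -> U x).
  { intros x Hx. apply NNPP; intro Nx. rewrite (Hphi1 x Nx), Rabs_R1 in Hx. lra. }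
  destruct (cluster_of_sequence TM A (fun n => q_ n) HT Hh Hcc HA) as [m Hm].
  destruct (Heq phi Hphi m (1 / 4)%R) as (W & HW & Wm & HWeq); [lra|].
  destruct (Hm W HW Wm 0) as (n & _ & Wn).
  destruct (Hm W HW Wm (S n)) as (k & Hk & Wk).
  assert (Hclose : forall y,
    (Rabs (phi (mul (q_ k) y) - phi (mul (q_ n) y)) <= 1 / 2)%R).
  { intro y. pose proof (HWeq _ y Wn) as H1. pose proof (HWeq _ y Wk) as H2.
    revert H1 H2. unfold Rabs. repeat destruct Rcase_abs; lra. }
  assert (Hk' : k = n + (k - n)) by lia.
  assert (k - n = 0); [|lia].
  apply HUn; apply HphiU.
  (* Translating by [p_ n] turns [q_ n] into [e] and [q_ k] into [q_ (k - n)]; below, [p_ k] turns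
     [q_ k] into [e] and [q_ n] into [p_ (k - n)]. Since [phi e = 0], both values are at most
     [1 / 2 < 1]. *)
  - specialize (Hclose (p_ n)). revert Hclose.
    rewrite mul_q_p, Hk', npow_sub, <- Hk', Hphi0; auto.
    unfold Rabs; repeat destruct Rcase_abs; lra.
  - specialize (Hclose (p_ k)). revert Hclose.
    rewrite mul_q_p, Hphi0, (mulC (q_ n)), Hk', npow_sub, <- Hk'; auto.
    + unfold Rabs; repeat destruct Rcase_abs; lra.
    + rewrite mulC; auto.
Qed.

Lemma mul_jointly_continuous (phi : M -> R) :
  continuous TM R_top phi -> jointly_continuous TM TM (fun x y => phi (mul x y)).
Proof.
  intros Hphi x y eps Heps.
  destruct (proj2 Hsg x y (fun z => Rabs (phi z - phi (mul x y)) < eps)%R)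
    as (U & V & HU & HV & Ux & Vy & HUV).
  - apply (Hphi (fun r => Rabs (r - phi (mul x y)) < eps)%R).
    intros r Hr. exists (eps - Rabs (r - phi (mul x y)))%R; split; [lra|].
    intros s Hs. revert Hr Hs. unfold Rabs; repeat destruct Rcase_abs; lra.
  - rewrite Rminus_diag, Rabs_R0; auto.
  - exists U, V; auto 10.
Qed.

Lemma locally_finite_not_openly_factorizable :
  locally_finite_powers -> tychonoff TM ->
  dense TM (fun m => exists c, pi c = m) ->
  countably_compact_at TM (fun m => exists c, pi c = m) ->
  ~ openly_factorizable TM.
Proof.
  intros HLF Htych Hd Hcc Hof.
  apply (no_equicontinuous_translates _ HLF Htych) with (2 := Hcc).
  { intro n; exists (0, n); apply pi_q. }
  intros phi Hphi m.
  apply (openly_factorizable_equicontinuous TM _ (fun n => pi (Cantor.of_nat n)))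
    with (5 := Hd) (6 := Hcc); auto using mul_jointly_continuous.
  - intro x; split.
    + intros [c <-]. exists (Cantor.to_nat c). rewrite Cantor.cancel_of_to; auto.
    + intros [n <-]; eauto.
  - intros n V HV.
    apply (right_translation_continuous TM mul (pi (of_nat n))
      HT Hsg (fun x => V (phi x))), Hphi, HV.
Qed.

Lemma locally_finite_square_not_pseudocompact :
  locally_finite_powers -> tychonoff TM ->
  countably_compact_at TM (fun m => exists c, pi c = m) ->
  ~ pseudocompact (product_top TM TM).
Proof.
  intros HLF Htych Hcc Hps.
  apply (no_equicontinuous_translates _ HLF Htych) with (2 := Hcc).
  { intro n; exists (0, n); apply pi_q. }
  intros phi Hphi m. apply (pseudocompact_product_equicontinuous TM TM); auto.
  apply mul_jointly_continuous, Hphi.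
Qed.

(** A unit [x] near [e] is close to some [h] in [H] with [h^-1] also near [e],
    and [x^-1 = (x^-1 h) h^-1]. *)
Lemma inverse_near_unit (H : M -> Prop) (inv : M -> M) (U : M -> Prop) :
  dense TM H -> (forall h, H h -> mul h (inv h) = e) -> H e ->
  (forall x V, H x -> TM V -> V (inv x) ->
     exists W, TM W /\ W x /\ forall h, H h -> W h -> V (inv h)) ->
  TM U -> U e ->
  exists W, TM W /\ W e /\ forall x y, W x -> mul x y = e -> U y.
Proof.
  intros Hd Hinv He Hinvc HU Ue.
  destruct (proj2 Hsg e e U HU) as (A & B & HA & HB & Ae & Be & HAB).
  { rewrite mul1; auto. }
  destruct (Hinvc e B He HB) as (W & HW & We & HWB).
  { rewrite <- (mul1 (inv e)), Hinv; auto. }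
  exists W; repeat split; auto. intros x y Wx Hxy.
  destruct (Hd (fun h => W h /\ A (mul y h))) as (h & [Wh Ah] & Hh').
  - apply HT; auto. apply left_translation_continuous; auto.
  - exists x; split; auto. rewrite mulC, Hxy; auto.
  - assert (mul (mul y h) (inv h) = y) as <-.
    { rewrite <- mulA, Hinv, mulC; auto. }
    apply HAB; auto.
Qed.

(** By density each [q_ n] is approximated by some [h] in [H] with [(p_ n) h] in a small [W].
    Finitely many translates of [W] cover [H], so the approximants of two indices [n < k] share a
    translate. Hence [(q_ k) (p_ n)] and [(q_ n) (p_ k)], which are the powers [k - n] of [pi q] and
    [pi p], both lie in [U]. *)
Lemma locally_finite_no_totally_bounded_subgroup (H : M -> Prop) :
  locally_finite_powers -> dense TM H ->
  ~ totally_bounded_topological_subgroup TM mul H.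
Proof.
  intros HLF Hd (e' & inv & He' & Hunit & _ & Hinv & _ & Hinvc & Htb).
  assert (e' = e) as ->.
  { rewrite <- (mul_e_r mul e mul1 mulC e').
    apply (continuous_eq_on_dense TM TM H (mul e') (fun x => x)); auto.
    - apply left_translation_continuous; auto.
    - apply identity_continuous.
    - intros x Hx; apply Hunit, Hx. }
  destruct (locally_finite_unit_nbhd HLF) as (U & HU & Ue & HUn).
  assert (Hsq : forall V, TM V -> V e -> exists W, TM W /\ W e /\
    forall x y, W x -> W y -> V (mul x y)).
  { intros V HV Ve. destruct (proj2 Hsg e e V HV) as (A & B & HA & HB & Ae & Be & HAB).
    - rewrite mul1; auto.
    - exists (fun x => A x /\ B x). split; [apply HT; auto|]. firstorder. }
  (* [U] is halved twice because [Hprod] multiplies four factors from [P]. *)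
  destruct (Hsq U HU Ue) as (V & HV & Ve & HVU).
  destruct (Hsq V HV Ve) as (P & HP & Pe & HPV).
  destruct (inverse_near_unit H inv P Hd) as (W0 & HW0 & W0e & HW0P); auto.
  { intros h Hh'; apply Hinv, Hh'. }
  set (W := fun x => P x /\ W0 x).
  assert (HW : TM W) by (apply HT; auto).
  destruct (Htb W HW) as (l & Hl & Hcov); [split; auto|].
  destruct (infinite_pigeonhole l (fun n f => exists h u,
    H h /\ W (mul (p_ n) h) /\ H u /\ W u /\ h = mul f u)) as (f & Hf & Hinfn).
  { intro n. destruct (Hd (fun h => W (mul (p_ n) h))) as (h & Wh & Hh').
    - apply (left_translation_continuous TM mul (p_ n)); auto.
    - exists (q_ n). rewrite mulC, mul_q_p. split; auto.
    - destruct (Hcov h Hh') as (f & u & Hf & Hu & Wu & Hfu). exists f; eauto 10. }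
  destruct (Hinfn 0) as (n & _ & h & u & Hhn & Wh & Hu & Wu & E).
  destruct (Hinfn (S n)) as (k & Hk & h' & u' & Hh' & Wh' & Hu' & Wu' & E').
  assert (Hinv' : forall h, H h -> mul h (inv h) = e) by (intros; apply Hinv; auto).
  (* [q^i p^j] is the product of [p^j h1], [(p^i h2)^-1], [u2] and [u1^-1] *)
  assert (Hprod : forall i j h1 u1 h2 u2,
    H h1 -> H u1 -> H h2 -> H u2 ->
    W (mul (p_ j) h1) -> W u1 -> W (mul (p_ i) h2) -> W u2 ->
    h1 = mul f u1 -> h2 = mul f u2 -> U (mul (q_ i) (p_ j))).
  { intros i j h1 u1 h2 u2 Hh1 Hu1 Hh2 Hu2 [Ph1 _] [_ Wu1] [_ Wh2] [Pu2 _] E1 E2.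
    assert (Hf1 : mul h1 (inv u1) = f).
    { rewrite E1, <- mulA, Hinv', mulC; auto. }
    assert (Hf2 : mul f (mul (inv h2) u2) = e).
    { rewrite (mulC (inv h2)), mulA, <- E2; auto. }
    assert (mul (mul (mul (p_ j) h1) (mul (q_ i) (inv h2))) (mul u2 (inv u1))
      = mul (q_ i) (p_ j)) as <-.
    { rewrite (mulACA mul mulA mulC (p_ j)), <- mulA, (mulC u2).
      rewrite (mulACA mul mulA mulC h1), Hf1, Hf2, (mulC _ e), mul1; auto. }
    apply HVU; apply HPV; auto.
    - apply (HW0P _ _ Wh2).
      rewrite (mulACA mul mulA mulC), (mulC (p_ i)), mul_q_p, Hinv', mul1; auto.
    - apply (HW0P _ _ Wu1); auto. }
  assert (Hk' : k = n + (k - n)) by lia.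
  assert (k - n = 0); [|lia].
  apply HUn.
  - rewrite <- (npow_sub mul e mulA mul1 mulC _ (pi bp) n), <- Hk' by auto.
    apply (Hprod k n h u h' u'); auto.
  - rewrite <- (npow_sub mul e mulA mul1 mulC _ (pi bq) n), <- Hk'
      by (rewrite mulC; auto).
    rewrite mulC. apply (Hprod n k h' u' h u); auto.
Qed.

End BicyclicImage.

Local Close Scope nat_scope.

Theorem theorem4p1 (M : Type) (TM : topology M) (mul : M -> M -> M) (pi : bicyclic -> M)
  (HTM : is_topology TM) (Hhaus : hausdorff TM) (Hsg : topological_semigroup TM mul)
  (Hhom : forall a b, pi (bmul a b) = mul (pi a) (pi b))
  (HZ : infinite_cyclic_subgroup mul (fun m => exists c, pi c = m))
  (Hdense : dense TM (fun m => exists c, pi c = m))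
  (Hcc : countably_compact_at TM (fun m => exists c, pi c = m)) :
  (* (1) *)
  (countably_compact TM -> countably_compact (S_top TM pi)) /\
  (* (2) *)
  ((topological_semigroup (S_top TM pi) (S_mul mul pi) <->
      (forall c : bicyclic,
         closed (product_top (S_top TM pi) (S_top TM pi))
           (fun z => exists x y, z = (inl x, inl y) /\ bmul x y = c))) /\
   (topological_semigroup (S_top TM pi) (S_mul mul pi) <->
      (closed (product_top TM TM)
         (fun z => exists n, z = (pi (bpow bq n), pi (bpow bp n))) /\
       discrete_set (product_top TM TM)
         (fun z => exists n, z = (pi (bpow bq n), pi (bpow bp n)))))) /\
  (* (3) *)
  (discrete_set TM (fun m => exists c, pi c = m) ->
   ideal mul (fun m => ~ exists c, pi c = m) ->
   topological_semigroup (S_top TM pi) (S_mul mul pi)) /\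
  (* (4) *)
  (topological_semigroup (S_top TM pi) (S_mul mul pi) ->
   ~ pseudocompact (product_top (S_top TM pi) (S_top TM pi))) /\
  (* (5) *)
  (topological_semigroup (S_top TM pi) (S_mul mul pi) -> tychonoff TM ->
   ~ openly_factorizable TM /\
   ~ pseudocompact (product_top TM TM) /\
   ~ (exists H : M -> Prop, dense TM H /\ totally_bounded_topological_subgroup TM mul H)).
Proof.
  destruct (dense_cyclic_image TM mul pi HTM Hhaus Hsg Hhom HZ Hdense)
    as (e & mul1 & mulC & Hqp & Hinf & Hpi).
  set (LF := inverse_powers_locally_finite TM mul e (pi bq) (pi bp)).
  set (TS := topological_semigroup (S_top TM pi) (S_mul mul pi)).
  (* [LF] implies [TS], which implies closedness of every [factorizations c], whose case [bone]
     implies [LF]: this cycle gives the first equivalence of (2) and lets [LF] stand for [TS]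
     elsewhere. *)
  assert (HLFTS : LF -> TS).
  { apply locally_finite_topological_semigroup; auto. }
  assert (HTSD : TS -> forall c,
    closed (product_top (S_top TM pi) (S_top TM pi)) (factorizations c)).
  { intros HS c. apply (factorizations_closed TM mul); auto. }
  assert (HDLF : closed (product_top (S_top TM pi) (S_top TM pi)) (factorizations bone)
    -> LF).
  { apply closed_factorizations_locally_finite; auto. }
  assert (HTSLF : TS -> LF) by auto.
  split; [|split; [split|split; [|split]]].
  - apply S_countably_compact; auto.
  - split; [exact HTSD|]. intro HD. apply HLFTS, HDLF, HD.
  - rewrite <- (locally_finite_iff_closed_discrete TM mul e pi); auto.
    split; auto.
  - intros Hdis Hid. apply HLFTS, discrete_ideal_locally_finite; auto.
  - intro HS. apply factorizations_of_one_not_pseudocompact; auto.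
  - intros HS Htych. apply HTSLF in HS. split; [|split].
    + apply locally_finite_not_openly_factorizable with mul e pi; auto.
    + apply locally_finite_square_not_pseudocompact with mul e pi; auto.
    + intros (H & Hd & Htb). revert Htb.
      apply locally_finite_no_totally_bounded_subgroup with e pi; auto.
Qed.
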